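(* Let $\mathbb K$ be an algebraically closed field of characteristic $2$ and let $m\ge 3$. 1. The Lie algebra $\mathrm{Kap}_{4,B}(2m)$ is isomorphic to the Lie algebra whose space is $\mathcal O(2m;\underline N_s)$ with indeterminates $p_i$ and $q_i$, $1\le i\le m$, and with the bracket $$[f,g]=\sum_{1\le i\le m}(1+p_i)(1+q_i)\bigl(\partial_{p_i}f\cdot\partial_{q_i}g+\partial_{q_i}f\cdot\partial_{p_i}g\bigr).$$ 2. The Lie algebra $\mathrm{Kap}_{4,B}(2m)$ is isomorphic to a deform of the Poisson algebra $\mathfrak{po}_\Pi(2m;\underline N_s)$, namely to the space $\mathcal O(2m;\underline N_s)$ with the deformed bracket $$[f,g]_\hbar=\sum_{1\le i\le m}(1+\hbar p_iq_i)\bigl(\partial_{p_i}f\cdot\partial_{q_i}g+\partial_{q_i}f\cdot\partial_{p_i}g\bigr)\quad\text{for any }\hbar\in\mathbb K,\ \hbar\ne0,$$ and $$\mathrm{Kap}_{4,B}(2m)\simeq\mathrm{Kap}_2(2m)\oplus\mathfrak c,$$ where the center $\mathfrak c$ is generated by constant functions.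
   Context: Let $V$ be a $2m$-dimensional vector space over $\mathbb F_2$ with a nondegenerate alternating bilinear form $B$ (all such forms are equivalent; in the definition of $\mathrm{Kap}_{4,B}$ it is the polar form $B(u,v)=Q(u+v)+Q(u)+Q(v)$ of a nondegenerate quadratic form $Q$ on $V$). For the subsets $\Gamma=V$ and $\Gamma=V\setminus\{0\}$, let $\mathfrak g_\Gamma$ be the Lie algebra over $\mathbb K$ with basis $\{e_u\mid u\in\Gamma\}$ and bracket $[e_u,e_v]=B(u,v)e_{u+v}$ if $u\ne v$ and $u+v\in\Gamma$, and $[e_u,e_v]=0$ otherwise. Then $\mathrm{Kap}_{4,B}(2m):=\mathfrak g_V$ and $\mathrm{Kap}_2(2m):=\mathfrak g_{V\setminus\{0\}}$. $\mathcal O(2m;\underline N_s)$, where $\underline N_s=(1,\dots,1)$, is the algebra of truncated polynomials $\mathbb K[p_1,\dots,p_m,q_1,\dots,q_m]/(p_i^2,q_i^2)$ with the usual partial derivatives $\partial_{p_i},\partial_{q_i}$. The Poisson algebra $\mathfrak{po}_\Pi(2m;\underline N_s)$ is this space with the bracket $\{f,g\}=\sum_i(\partial_{p_i}f\,\partial_{q_i}g+\partial_{q_i}f\,\partial_{p_i}g)$; it is the case $\hbar=0$ of $[\cdot,\cdot]_\hbar$. ''Deform'' means the result of a deformation of the Lie bracket. In the realization by functions, ''constant functions'' means $\mathbb K\cdot1$, corresponding to $e_0$. *)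

(* Defs.v *)
From HB Require Import structures.
From mathcomp Require Import all_boot all_order all_fingroup all_algebra.
From mathcomp Require Import all_field.

Set Implicit Arguments.
Unset Strict Implicit.
Unset Printing Implicit Defensive.

Import GRing.Theory.
Local Open Scope ring_scope.

Section Lie.
Variable K : fieldType.
Implicit Types L : lmodType K.

Definition alternating L (mu : L -> L -> L) := forall x, mu x x = 0.

Definition jacobi L (mu : L -> L -> L) :=
  forall x y z, mu x (mu y z) + mu y (mu z x) + mu z (mu x y) = 0.

Definition lie_bracket L (mu : L -> L -> L) :=
  [/\ bilinear_for *:%R *:%R mu, alternating mu & jacobi mu].

(* Includes the claim that [mu1] and [mu2] are Lie brackets. *)
Definition lie_isomorphic L1 L2 (mu1 : L1 -> L1 -> L1) (mu2 : L2 -> L2 -> L2) :=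
  [/\ lie_bracket mu1, lie_bracket mu2 &
      exists2 phi : {linear L1 -> L2}, bijective phi &
        forall x y, phi (mu1 x y) = mu2 (phi x) (phi y)].

Definition sum_bracket L1 L2 (mu1 : L1 -> L1 -> L1) (mu2 : L2 -> L2 -> L2)
    (x y : (L1 * L2)%type) : (L1 * L2)%type :=
  (mu1 x.1 y.1, mu2 x.2 y.2).

Definition is_center (L : vectType K) (mu : L -> L -> L) (c : {vspace L}) :=
  forall z, z \in c <-> forall x, mu z x = 0.

(* Meaningful when [U] is a subalgebra: [vsproj U] is then applied to
   elements of [U] only. *)
Definition sub_bracket (L : vectType K) (mu : L -> L -> L) (U : {vspace L})
    (x y : subvs_of U) : subvs_of U :=
  vsproj U (mu (vsval x) (vsval y)).

(* [\sum_k t^k c_k] is a Lie bracket over the formal parameter [t]: the third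
   condition is the coefficient of [t^n] in the Jacobi identity. *)
Definition formal_lie_bracket L (c : nat -> L -> L -> L) :=
  [/\ forall k, bilinear_for *:%R *:%R (c k),
      forall k, alternating (c k) &
      forall n x y z,
        \sum_(i < n.+1) (c i x (c (n - i)%N y z) + c i y (c (n - i)%N z x)
                         + c i z (c (n - i)%N x y)) = 0].

(* [mu] is a deformation of [mu0], polynomial in the parameter, so that it can
   be evaluated at every [t : K]; the brackets [mu t] are the deforms. *)
Definition lie_deformation L (mu0 : L -> L -> L) (mu : K -> L -> L -> L) :=
  exists c : nat -> L -> L -> L, exists N : nat,
    [/\ formal_lie_bracket c,
        forall x y, c 0%N x y = mu0 x y,
        forall k x y, (N < k)%N -> c k x y = 0 &
        forall t x y, mu t x y = \sum_(k < N.+1) t ^+ k *: c k x y].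

End Lie.

Section Kap.
Variables (K : fieldType) (V : vectType 'F_2) (B : V -> V -> 'F_2).

(* [finvect_type V] is [V] with its canonical structure of finite type. *)
Definition kap_space (Gamma : {set finvect_type V}) : vectType K :=
  {ffun {u : finvect_type V | u \in Gamma} -> K^o}.

(* The basis vector e_w; it is 0 when [w \notin Gamma]. *)
Definition kap_basis (Gamma : {set finvect_type V}) (w : finvect_type V) :
    kap_space Gamma :=
  [ffun u => (val u == w)%:R].

(* [(B u v != 0)%:R] is the image of [B u v] under the inclusion of F_2 in K. *)
Definition kap_basis_bracket (Gamma : {set finvect_type V})
    (u v : finvect_type V) : kap_space Gamma :=
  if (u != v) && (u + v \in Gamma)
  then (B u v != 0)%:R *: kap_basis Gamma (u + v) else 0.

Definition kap_bracket (Gamma : {set finvect_type V})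
    (f g : kap_space Gamma) : kap_space Gamma :=
  \sum_u \sum_v (f u * g v : K) *: kap_basis_bracket Gamma (val u) (val v).

Definition kap4 := @kap_bracket [set: finvect_type V].
Definition kap2 := @kap_bracket [set~ (0 : finvect_type V)].

End Kap.

(* The algebra K[x_i | i : I] / (x_i ^ 2 | i : I):
   [f S] is the coefficient in [f] of the squarefree monomial
   [\prod_(i in S) x_i]. *)
Definition tpoly (K : fieldType) (I : finType) := {ffun {set I} -> K^o}.

HB.instance Definition _ (K : fieldType) (I : finType) :=
  Vector.copy (tpoly K I) {ffun {set I} -> K^o}.

Section TruncatedPolynomials.
Variables (K : fieldType) (I : finType).
Local Notation O := (tpoly K I).
Implicit Types (f g h : O) (S T : {set I}).

Lemma tpolyP f g : (forall S, f S = g S) -> f = g.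
Proof. by move=> eq_fg; apply/(@ffunP {set I} (fun=> K^o)). Qed.

Definition tpoly_one : O := [ffun S => (S == set0)%:R].

(* The product of the monomials of [A] and [A'] is that of [A :|: A'] when
   [A] and [A'] are disjoint, and 0 otherwise. *)
Definition tpoly_mul f g : O :=
  [ffun S : {set I} => \sum_(A : {set I} | A \subset S) (f A : K) * g (S :\: A)].

Lemma tpoly_mulC : commutative tpoly_mul.
Proof.
move=> f g; apply: tpolyP => S; rewrite !ffunE.
rewrite (reindex_onto (fun A => S :\: A) (fun A => S :\: A)) /=; last first.
  by move=> A sAS; rewrite setDDr setDv set0U; apply/setIidPr.
apply: eq_big => [A|A /andP[_ /eqP eqA]]; last by rewrite eqA mulrC.
rewrite subsetDl setDDr setDv set0U /=.
by apply/eqP/idP => [<-|]; [apply: subsetIl | move/setIidPr].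
Qed.

Lemma tpoly_mulA : associative tpoly_mul.
Proof.
move=> f g h; apply: tpolyP => S; rewrite !ffunE.
under eq_bigr do rewrite ffunE big_distrr /=.
under [RHS]eq_bigr do rewrite ffunE big_distrl /=.
rewrite [RHS](exchange_big_dep (fun A : {set I} => A \subset S)) /=; last first.
  by move=> C A sCS sAC; apply: subset_trans sAC sCS.
apply: eq_bigr => A sAS.
rewrite [RHS](reindex_onto (fun C => A :|: C) (fun C => C :\: A)) /=; last first.
  by move=> C /andP[_ sAC]; rewrite -{1}(setIidPr sAC) setID.
apply: eq_big => [C|C sC]; last first.
  have dAC: [disjoint C & A] by move: sC; rewrite subsetD => /andP[].
  rewrite setDUl setDv set0U -setDDl mulrA.
  by rewrite (_ : C :\: A = C) //; apply/setDidPl.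
rewrite subUset sAS subsetUl andbT setDUl setDv set0U subsetD /=.
by congr (_ && _); apply/setDidPl/eqP.
Qed.

Lemma tpoly_mul1 : left_id tpoly_one tpoly_mul.
Proof.
move=> f; apply: tpolyP => S; rewrite ffunE (bigD1 set0) ?sub0set //=.
rewrite ffunE eqxx mul1r setD0 big1 ?addr0 // => A /andP[_ /negbTE nA].
by rewrite ffunE nA mul0r.
Qed.

Lemma tpoly_mulDl : left_distributive tpoly_mul +%R.
Proof.
move=> f g h; apply: tpolyP => S; rewrite !ffunE -big_split /=.
by apply: eq_bigr => A _; rewrite !ffunE mulrDl.
Qed.

Lemma tpoly_one_neq0 : tpoly_one != 0.
Proof.
apply/eqP=> /(congr1 (fun f : O => f set0))/eqP.
by rewrite !ffunE eqxx oner_eq0.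
Qed.

HB.instance Definition _ := GRing.Zmodule_isComNzRing.Build O
  tpoly_mulA tpoly_mulC tpoly_mul1 tpoly_mulDl tpoly_one_neq0.

Lemma tpoly_scaleAl (a : K) f g : a *: (f * g) = a *: f * g.
Proof.
apply: tpolyP => S; rewrite !ffunE scaler_sumr.
by apply: eq_bigr => A _; rewrite ffunE; exact: mulrA.
Qed.

HB.instance Definition _ := GRing.Lmodule_isLalgebra.Build K O tpoly_scaleAl.
HB.instance Definition _ := GRing.Lalgebra_isComAlgebra.Build K O.

Definition tpoly_mon S : O := [ffun T => (T == S)%:R].

Definition tpoly_var (i : I) : O := tpoly_mon [set i].

Definition tpoly_deriv (i : I) f : O :=
  [ffun S : {set I} => if i \in S then 0 else f (i |: S)].

(* [tpoly K I] is generated by the [x_i], which square to 0, and has as basis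
    their squarefree products: it is K[x_i] / (x_i ^ 2). *)

Lemma tpoly_mon_mul S T :
  tpoly_mon S * tpoly_mon T
  = if [disjoint S & T] then tpoly_mon (S :|: T) else 0.
Proof.
apply: tpolyP => A; rewrite ffunE /=.
have [sSA|nSA] := boolP (S \subset A); last first.
  rewrite big1 => [|C sCA].
    case: ifP => _; rewrite !ffunE //.
    by case: eqP nSA => // ->; rewrite subsetUl.
  rewrite !ffunE; case: eqP => [eC|]; last by rewrite mul0r.
  by rewrite -eC sCA in nSA.
rewrite (bigD1 S) //= !ffunE eqxx mul1r big1 ?addr0; last first.
  by move=> C /andP[_ /negbTE nC]; rewrite ffunE nC mul0r.
have [eT|nT] := eqVneq (A :\: S) T.
  have dST : [disjoint S & T] by rewrite -eT disjoint_sym disjoints_subset subsetDr.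
  rewrite dST ffunE -eT; suff -> : S :|: A :\: S = A by rewrite eqxx.
  by rewrite -{2}(setID A S) (setIidPr sSA).
case: ifP => dST; rewrite !ffunE //.
case: eqP => // eA; case/eqP: nT; rewrite eA setDUl setDv set0U.
by apply/setDidPl; rewrite disjoint_sym.
Qed.

Lemma tpoly_mon0 : tpoly_mon set0 = 1.
Proof. by []. Qed.

Lemma tpoly_monE S : tpoly_mon S = \prod_(i in S) tpoly_var i.
Proof.
have [n] := ubnP #|S|; elim: n S => // n IH S le_S_n.
have [->|[i iS]] := set_0Vmem S; first by rewrite big_set0.
rewrite (big_setD1 i) //= -IH; last by rewrite (cardsD1 i S) iS in le_S_n.
rewrite tpoly_mon_mul disjoints1 !inE eqxx /=.
by rewrite setD1K.
Qed.

Lemma tpoly_var_sqr i : tpoly_var i ^+ 2 = 0.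
Proof.
by rewrite expr2 tpoly_mon_mul disjoints1 set11.
Qed.

Lemma tpoly_sum_mon f : f = \sum_S (f S : K) *: tpoly_mon S.
Proof.
apply: tpolyP => T; rewrite sum_ffunE (bigD1 T) //= !ffunE eqxx.
rewrite big1 ?addr0 => [|S /negbTE nS]; first by rewrite /GRing.scale /= mulr1.
by rewrite !ffunE eq_sym nS /GRing.scale /= mulr0.
Qed.

Lemma tpoly_deriv_is_linear i : linear (tpoly_deriv i).
Proof.
move=> a f g; apply: tpolyP => S; rewrite !ffunE.
by case: ifP => _; rewrite ?scaler0 ?addr0 ?ffunE.
Qed.

HB.instance Definition _ i :=
  GRing.isLinear.Build K O O *:%R (tpoly_deriv i) (tpoly_deriv_is_linear i).

Lemma tpoly_deriv_mon i S :
  tpoly_deriv i (tpoly_mon S) = if i \in S then tpoly_mon (S :\ i) else 0.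
Proof.
apply: tpolyP => T; rewrite ffunE.
have [iT|niT] := ifPn.
  case: ifP => _; rewrite !ffunE //.
  by case: eqP => // eT; rewrite eT !inE eqxx in iT.
rewrite ffunE; have [iS|niS] := ifPn; rewrite ffunE; last first.
  by case: eqP => // eS; rewrite -eS setU11 in niS.
suff -> : (i |: T == S) = (T == S :\ i) by [].
by apply/eqP/eqP => [<-|->]; rewrite ?setU1K ?setD1K.
Qed.

End TruncatedPolynomials.

(* The indices [inl i] and [inr i] are those of p_i and q_i. *)
Notation Oalg K m := (tpoly K ('I_m + 'I_m)%type).

Section Brackets.
Variables (K : fieldType) (m : nat).
Local Notation Oalg := (Oalg K m).

Definition pvar (i : 'I_m) : Oalg := tpoly_var K (inl i).
Definition qvar (i : 'I_m) : Oalg := tpoly_var K (inr i).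
Definition dp (i : 'I_m) (f : Oalg) : Oalg := tpoly_deriv (inl i) f.
Definition dq (i : 'I_m) (f : Oalg) : Oalg := tpoly_deriv (inr i) f.

Definition po_bracket (f g : Oalg) : Oalg :=
  \sum_(i < m) (dp i f * dq i g + dq i f * dp i g).

Definition log_bracket (f g : Oalg) : Oalg :=
  \sum_(i < m) (1 + pvar i) * (1 + qvar i) * (dp i f * dq i g + dq i f * dp i g).

Definition hbar_bracket (hbar : K) (f g : Oalg) : Oalg :=
  \sum_(i < m)
    (1 + hbar *: (pvar i * qvar i)) * (dp i f * dq i g + dq i f * dp i g).

End Brackets.

Arguments pvar K {m} i.
Arguments qvar K {m} i.
Arguments kap_bracket K {V} B Gamma f g.
Arguments kap4 K {V} B.
Arguments kap2 K {V} B.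
Arguments kap_basis K {V} Gamma w.
Arguments po_bracket K m : clear implicits.
Arguments log_bracket K m : clear implicits.
Arguments hbar_bracket K m : clear implicits.

(* Main.v *)
Require Import Defs.
From HB Require Import structures.
From mathcomp Require Import all_boot all_order all_fingroup all_algebra.
From mathcomp Require Import all_field.
From mathcomp Require Import ring.

Set Implicit Arguments.
Unset Strict Implicit.
Unset Printing Implicit Defensive.

Import GRing.Theory.
Local Open Scope ring_scope.

(** Write x^u for the product of the x_j raised to the coordinates of u in F_2, with
    respect to a symplectic basis of V. If elements x_j of the truncated polynomial
    algebra satisfy x_j ^ 2 = 1, then x^u x^v = x^(u+v). If moreover
    {x_j, x_k} = kappa x_j x_k when x_j and x_k are partners in a hyperbolic pair and
    0 otherwise, then, a bracket of Poisson type being a derivation in each argument,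
    {x^u, x^v} = kappa B(u,v) x^(u+v). So e_u |-> kappa^-1 x^u is a homomorphism from
    the algebra on V. Its image is the subalgebra generated by the x_j; if this is
    everything, comparing dimensions makes the map an isomorphism. It only remains to
    find such coordinates:
    - for the bracket with weights (1 + p_i)(1 + q_i), the elements 1 + p_i, 1 + q_i,
      with kappa = 1;
    - for the bracket with weights 1 + hbar p_i q_i, the elements
      1 + hbar p_i + hbar p_i q_i and 1 + q_i + hbar p_i q_i, with kappa = hbar
      ([hbar_coord_canonical]).

    The symplectic basis is built one hyperbolic pair at a time
    ([symplectic_extend]), and the homomorphism property is
    [scaled_exponential_morph].

    The Lie algebra axioms are checked once, on the basis e_u, and carried along
    isomorphisms. In particular the deformed bracket satisfies the Jacobi identity
    for every nonzero value of the parameter; since K is infinite, this gives the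
    identity coefficient by coefficient, hence also for the Poisson bracket itself
    ([hbar_formal]).

    The center of the algebra on V consists of the multiples of e_0 because B is
    nondegenerate, and e_0 corresponds to the constants. The vectors e_u with u != 0
    span a complementary subalgebra because u + v = 0 only for u = v, when the bracket
    is zero anyway ([kap2_inclusion_morph]). *)

(** * Bilinear brackets: bases and transport *)

Section Bilinear.
Variables (K : fieldType) (L : lmodType K) (mu : L -> L -> L).
Hypothesis mu_bil : bilinear_for *:%R *:%R mu.

Let mub : {bilinear L -> L -> L} :=
  HB.pack mu (@bilinear_isBilinear.Build K L L L *:%R *:%R mu mu_bil).

Lemma bilinear_suml (I : Type) (r : seq I) (a : I -> K) (x : I -> L) y :
  mu (\sum_(i <- r) a i *: x i) y = \sum_(i <- r) a i *: mu (x i) y.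
Proof.
rewrite -[mu]/(mub : L -> L -> L) linear_sumlz.
by apply: eq_bigr => i _; rewrite linearZl_LR.
Qed.

Lemma bilinear_sumr (I : Type) (r : seq I) (a : I -> K) (x : I -> L) y :
  mu y (\sum_(i <- r) a i *: x i) = \sum_(i <- r) a i *: mu y (x i).
Proof.
rewrite -[mu]/(mub : L -> L -> L) linear_sumr.
by apply: eq_bigr => i _; rewrite linearZr_LR.
Qed.

Lemma bilinearDl x y z : mu (x + y) z = mu x z + mu y z.
Proof. by rewrite -[mu]/(mub : L -> L -> L) linearDl. Qed.

Lemma bilinearDr x y z : mu z (x + y) = mu z x + mu z y.
Proof. by rewrite -[mu]/(mub : L -> L -> L) linearDr. Qed.

Lemma bilinearZl a x y : mu (a *: x) y = a *: mu x y.
Proof. by rewrite -[mu]/(mub : L -> L -> L) linearZl_LR. Qed.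

Lemma bilinearZr a x y : mu x (a *: y) = a *: mu x y.
Proof. by rewrite -[mu]/(mub : L -> L -> L) linearZr_LR. Qed.

Lemma bilinear0l y : mu 0 y = 0.
Proof. by rewrite -[mu]/(mub : L -> L -> L) linear0l. Qed.

Lemma bilinear0r y : mu y 0 = 0.
Proof. by rewrite -[mu]/(mub : L -> L -> L) linear0r. Qed.

Variables (I : finType) (e : I -> L).
Hypothesis e_span : forall x, exists a : I -> K, x = \sum_i a i *: e i.

(** The Jacobiator is invariant under cyclic permutation, so linearity in its
    first argument suffices to reduce all three arguments to basis vectors. *)
Lemma jacobi_basis :
  (forall i j k, mu (e i) (mu (e j) (e k)) + mu (e j) (mu (e k) (e i))
                 + mu (e k) (mu (e i) (e j)) = 0) -> jacobi mu.
Proof.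
pose J x y z := mu x (mu y z) + mu y (mu z x) + mu z (mu x y).
have Jcyc x y z : J x y z = J y z x by rewrite /J -addrA addrC.
have Jlin y z : (forall i, J (e i) y z = 0) -> forall x, J x y z = 0.
  move=> J0 x; have [a ->] := e_span x; rewrite /J.
  rewrite !(bilinear_suml, bilinear_sumr) -!big_split big1 // => i _ /=.
  by rewrite -!scalerDr [X in _ *: X](J0 i) scaler0.
move=> Je x y z; rewrite -[LHS]/(J x y z).
apply: (Jlin _ _) => i; rewrite Jcyc; apply: (Jlin _ _) => j; rewrite Jcyc.
by apply: (Jlin _ _) => k; exact: Je.
Qed.

(** In characteristic 2 the off-diagonal terms of mu x x cancel in pairs. *)
Lemma alternating_basis : 2%N \in [pchar K] ->
  (forall i, mu (e i) (e i) = 0) ->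
  (forall i j, mu (e i) (e j) = mu (e j) (e i)) -> alternating mu.
Proof.
move=> char2 mu_diag mu_sym x; have [a ->] := e_span x.
elim: (index_enum I) => [|i r IHr]; first by rewrite big_nil bilinear0l.
rewrite big_cons bilinearDl !bilinearDr IHr addr0 bilinearZl bilinearZr.
rewrite mu_diag !scaler0 add0r bilinearZl bilinearZr bilinear_sumr.
have -> : mu (\sum_(j <- r) a j *: e j) (e i)
          = \sum_(j <- r) a j *: mu (e i) (e j).
  by rewrite bilinear_suml; apply: eq_bigr => j _; rewrite mu_sym.
by rewrite -mulr2n -scaler_nat (pcharf0 char2) scale0r.
Qed.

End Bilinear.

Section Transport.
Variable K : fieldType.

Lemma lie_bracket_pullback (L1 L2 : lmodType K) (mu1 : L1 -> L1 -> L1)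
    (mu2 : L2 -> L2 -> L2) (phi : {linear L1 -> L2}) :
  injective phi -> (forall x y, phi (mu1 x y) = mu2 (phi x) (phi y)) ->
  lie_bracket mu2 -> lie_bracket mu1.
Proof.
move=> phi_inj phiM [[bil_l bil_r] alt jac]; split.
- split=> x a y z; apply: phi_inj.
  + by rewrite linearP !phiM linearP bil_l.
  + by rewrite linearP !phiM linearP bil_r.
- by move=> x; apply: phi_inj; rewrite phiM alt linear0.
- by move=> x y z; apply: phi_inj; rewrite !linearD !phiM jac linear0.
Qed.

Lemma lie_isomorphic_sym (L1 L2 : lmodType K) (mu1 : L1 -> L1 -> L1)
    (mu2 : L2 -> L2 -> L2) :
  lie_isomorphic mu1 mu2 -> lie_isomorphic mu2 mu1.
Proof.
case=> lie1 lie2 [phi [psi phiK psiK] phiM].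
pose psil : {linear L2 -> L1} :=
  HB.pack psi (GRing.isLinear.Build _ _ _ _ psi (can2_linear phiK psiK)).
split=> //; exists psil; first by exists phi.
by move=> x y; apply: (can_inj phiK); rewrite phiM !psiK.
Qed.

(** Being a Lie bracket need only be known on one side of a linear bijection.
    The Jacobi identity of the brackets on truncated polynomials, which involves
    second derivatives, is obtained in this way. *)
Lemma lie_isomorphic_domain (L1 L2 : lmodType K) (mu1 : L1 -> L1 -> L1)
    (mu2 : L2 -> L2 -> L2) (phi : {linear L1 -> L2}) :
  lie_bracket mu1 -> bijective phi ->
  (forall x y, phi (mu1 x y) = mu2 (phi x) (phi y)) -> lie_isomorphic mu1 mu2.
Proof.
move=> lie1 phi_bij phiM; split=> //; last by exists phi.
have [psi phiK psiK] := phi_bij.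
pose psil : {linear L2 -> L1} :=
  HB.pack psi (GRing.isLinear.Build _ _ _ _ psi (can2_linear phiK psiK)).
apply: (@lie_bracket_pullback _ _ mu2 mu1 psil) => //; first exact: can_inj psiK.
by move=> x y; apply: (can_inj phiK); rewrite phiM !psiK.
Qed.

Lemma is_center_line_image (L1 L2 : vectType K) (mu1 : L1 -> L1 -> L1)
    (mu2 : L2 -> L2 -> L2) (phi : {linear L1 -> L2}) c :
  bijective phi -> (forall x y, phi (mu1 x y) = mu2 (phi x) (phi y)) ->
  is_center mu1 <[c]>%VS -> is_center mu2 <[phi c]>%VS.
Proof.
move=> [psi phiK psiK] phiM ctr z; split=> [/vlineP[a ->] x|z_ctr].
  rewrite -[x]psiK -linearZ -phiM (ctr (a *: c)).1 ?linear0 //.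
  exact/memvZ/memv_line.
have /vlineP[a psi_z] : psi z \in <[c]>%VS.
  by apply/(ctr _) => x; apply: (can_inj phiK); rewrite phiM psiK z_ctr linear0.
by apply/vlineP; exists a; rewrite -linearZ -psi_z psiK.
Qed.

Lemma line_scale (L : vectType K) (a : K) (x : L) :
  a != 0 -> <[a *: x]>%VS = <[x]>%VS.
Proof.
move=> a_neq0; apply/eqP; rewrite eqEsubv -!memvE memvZ ?memv_line //=.
by rewrite -[x in x \in _](scalerK a_neq0) memvZ ?memv_line.
Qed.

Lemma surjective_bij (aT rT : vectType K) (phi : {linear aT -> rT}) :
  \dim {: aT} = \dim {: rT} -> limg (linfun phi) = fullv -> bijective phi.
Proof.
move=> dim_eq phi_full.
have phi_inj : injective phi.
  move=> x y eq_phi; apply: (@lker0P _ _ _ (linfun phi) _); last by rewrite !lfunE.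
  rewrite -dimv_eq0 -(eqn_add2r (\dim (limg (linfun phi)))) -{1}[lker _]capfv.
  by rewrite limg_ker_dim phi_full dim_eq.
have phi_surj y : exists x, phi x == y.
  have /memv_imgP[x _ ->] : y \in limg (linfun phi) by rewrite phi_full memvf.
  by exists x; rewrite lfunE.
exists (fun y => xchoose (phi_surj y)) => [x|y].
  exact: phi_inj (eqP (xchooseP (phi_surj _))).
exact: (eqP (xchooseP (phi_surj y))).
Qed.

Lemma dim_ffun (I : finType) : \dim {: {ffun I -> K^o}} = #|I|.
Proof. by rewrite dimvf /dim /= muln1. Qed.

End Transport.

(** * Scalars in the field of two elements *)

Lemma F2_cases (a : 'F_2) : a = 0 \/ a = 1.
Proof.
by case: a => [[|[|n]] lt_n2] //; [left | right]; apply: val_inj.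
Qed.

Lemma F2_vect_add2 (V : lmodType 'F_2) (v : V) : v + v = 0.
Proof.
by rewrite -mulr2n -scaler_nat (_ : 2%:R = 0) ?scale0r //; apply: val_inj.
Qed.

Section F2Embedding.
Variables (K : fieldType).
Hypothesis char2 : 2%N \in [pchar K].

Lemma pchar2_add_self (L : lmodType K) (x : L) : x + x = 0.
Proof. by rewrite -mulr2n -scaler_nat (pcharf0 char2) scale0r. Qed.

(** The inclusion of the prime field in [K], in the form in which structure
    constants occur. *)
Definition F2inc (a : 'F_2) : K := (a != 0)%:R.

Lemma F2inc0 : F2inc 0 = 0. Proof. by rewrite /F2inc eqxx. Qed.

Lemma F2inc1 : F2inc 1 = 1. Proof. by []. Qed.

Lemma F2incD : {morph F2inc : a b / a + b}.
Proof.
move=> a b; have [-> | ->] := F2_cases a; first by rewrite F2inc0 !add0r.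
have [-> | ->] := F2_cases b; first by rewrite F2inc0 !addr0.
rewrite (_ : 1 + 1 = 0); last exact: val_inj.
by rewrite F2inc0 F2inc1 (addrr_pchar2 char2).
Qed.

Lemma F2incM : {morph F2inc : a b / a * b}.
Proof.
move=> a b; have [-> | ->] := F2_cases a; first by rewrite F2inc0 !mul0r F2inc0.
by rewrite F2inc1 !mul1r.
Qed.

Lemma F2inc_sum (I : Type) (r : seq I) (a : I -> 'F_2) :
  F2inc (\sum_(i <- r) a i) = \sum_(i <- r) F2inc (a i).
Proof. exact: (big_morph F2inc F2incD F2inc0). Qed.

End F2Embedding.

Lemma F2_form_sym (V : vectType 'F_2) (B : {skew_symmetric V}) u v :
  B u v = B v u.
Proof.
rewrite hermC /= expr1 mulN1r.
by have [-> | ->] := F2_cases (B v u); rewrite ?oppr0 //; apply: val_inj.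
Qed.

(** * Linear maps out of the Kaplansky algebras *)

Section KapExtension.
Variables (K : fieldType) (V : vectType 'F_2) (B : V -> V -> 'F_2).
Variable Gamma : {set finvect_type V}.
Local Notation kap := (kap_space K Gamma).
Local Notation kap_e := (kap_basis K Gamma).

Lemma kapP (f g : kap) : (forall u, f u = g u) -> f = g.
Proof.
by move=> eq_fg; apply/(@ffunP _ (fun=> K^o)).
Qed.

Lemma kap_sum_basis (f : kap) : f = \sum_u (f u : K) *: kap_e (val u).
Proof.
apply: kapP => v; rewrite sum_ffunE (bigD1 v) //= !ffunE eqxx.
rewrite big1 ?addr0 => [|u /negbTE neq_uv]; first by rewrite /GRing.scale /= mulr1.
by rewrite !ffunE val_eqE eq_sym neq_uv scaler0.
Qed.

Definition kap_extend (L : lmodType K) (E : finvect_type V -> L) (f : kap) : L :=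
  \sum_u (f u : K) *: E (val u).

Lemma kap_extend_is_linear (L : lmodType K) (E : finvect_type V -> L) :
  linear (kap_extend E).
Proof.
move=> a f g; rewrite /kap_extend scaler_sumr -big_split /=.
by apply: eq_bigr => u _; rewrite !ffunE scalerDl scalerA.
Qed.

HB.instance Definition _ (L : lmodType K) (E : finvect_type V -> L) :=
  GRing.isLinear.Build K kap L *:%R (kap_extend E) (kap_extend_is_linear E).

Lemma kap_extend_basis (L : lmodType K) (E : finvect_type V -> L) w :
  w \in Gamma -> kap_extend E (kap_e w) = E w.
Proof.
move=> wG; rewrite /kap_extend (bigD1 (Sub w wG)) //= ffunE SubK eqxx scale1r.
rewrite big1 ?addr0 // => u; rewrite -val_eqE /= => /negbTE neq_uw.
by rewrite ffunE neq_uw scale0r.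
Qed.

Lemma kap_bracket_bilinear : bilinear_for *:%R *:%R (@kap_bracket K V B Gamma).
Proof.
split=> h a f g; rewrite /= /kap_bracket scaler_sumr -big_split /=.
  apply: eq_bigr => u _; rewrite scaler_sumr -big_split /=.
  apply: eq_bigr => v _; rewrite !ffunE scalerA -scalerDl; congr (_ *: _).
  by rewrite mulrDl; congr (_ + _); rewrite /GRing.scale /= mulrA.
apply: eq_bigr => u _; rewrite scaler_sumr -big_split /=.
apply: eq_bigr => v _; rewrite !ffunE scalerA -scalerDl; congr (_ *: _).
by rewrite mulrDr; congr (_ + _); rewrite /GRing.scale /= mulrCA.
Qed.

Lemma kap_extend_morph (L : lmodType K) (mu : L -> L -> L)
    (E : finvect_type V -> L) :
  bilinear_for *:%R *:%R mu ->
  {in Gamma &, forall u v,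
     kap_extend E (kap_basis_bracket K B Gamma u v) = mu (E u) (E v)} ->
  forall f g, kap_extend E (kap_bracket K B Gamma f g)
              = mu (kap_extend E f) (kap_extend E g).
Proof.
move=> mu_bil EM f g.
rewrite [kap_extend E f]/kap_extend [kap_extend E g]/kap_extend.
rewrite /kap_bracket linear_sum (bilinear_suml mu_bil).
apply: eq_bigr => u _; rewrite linear_sum (bilinear_sumr mu_bil) scaler_sumr.
apply: eq_bigr => v _; rewrite linearZ /= scalerA EM //.
  exact: (valP u).
exact: (valP v).
Qed.

End KapExtension.

Lemma kap_bracket_basis (K : fieldType) (V : vectType 'F_2)
    (B : V -> V -> 'F_2) (Gamma : {set finvect_type V}) u v :
  u \in Gamma -> v \in Gamma ->
  kap_bracket K B Gamma (kap_basis K Gamma u) (kap_basis K Gamma v)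
  = kap_basis_bracket K B Gamma u v.
Proof.
move=> uG vG; rewrite -(kap_extend_basis (kap_basis_bracket K B Gamma u) vG).
rewrite -(kap_extend_basis (fun u => kap_extend (kap_basis_bracket K B Gamma u)
  (kap_basis K Gamma v)) uG).
apply: eq_bigr => u' _; rewrite scaler_sumr.
by apply: eq_bigr => v' _; rewrite scalerA.
Qed.

(** * The algebra on all of V: Lie structure, center, splitting *)

Section Kap4.
Variables (K : fieldType) (V : vectType 'F_2) (B : {skew_symmetric V}).
Hypothesis char2 : 2%N \in [pchar K].
Hypothesis B_alt : forall v : V, B v v = 0.

Local Notation T := (finvect_type V).
Local Notation e := (kap_basis K [set: T]).
Local Notation mu := (kap4 K B).

Lemma kap4_bilinear : bilinear_for *:%R *:%R mu.
Proof. exact: kap_bracket_bilinear. Qed.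

Lemma kap4_basis_bracketE u v :
  kap_basis_bracket K B [set: T] u v = F2inc K (B u v) *: e (u + v).
Proof.
rewrite /kap_basis_bracket in_setT andbT; have [-> | //] := eqVneq u v.
by rewrite B_alt F2inc0 scale0r.
Qed.

Lemma kap4_basis u v : mu (e u) (e v) = F2inc K (B u v) *: e (u + v).
Proof. by rewrite /kap4 kap_bracket_basis ?in_setT // kap4_basis_bracketE. Qed.

Lemma kap4_span x :
  exists a : {u : T | u \in [set: T]} -> K, x = \sum_u a u *: e (val u).
Proof. by exists x; rewrite -kap_sum_basis. Qed.

(** On basis vectors, with a = B v w, b = B w u and c = B u v, the Jacobi identity
    is a (c + b) + b (a + c) + c (b + a) = 0. *)
Lemma kap4_lie : lie_bracket mu.
Proof.
split; first exact: kap4_bilinear.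
- apply: (alternating_basis kap4_bilinear kap4_span char2) => [u | u v].
    by rewrite kap4_basis B_alt F2inc0 scale0r.
  by rewrite !kap4_basis F2_form_sym addrC.
- apply: (jacobi_basis kap4_bilinear kap4_span) => u v w.
  move: (val u) (val v) (val w) => {}u {}v {}w.
  rewrite !(kap4_basis, bilinearZr kap4_bilinear) !scalerA -!(F2incM, F2incD).
  have -> : v + (w + u) = u + (v + w) by rewrite addrA addrC.
  have -> : w + (u + v) = u + (v + w) by rewrite addrC addrA.
  rewrite -!scalerDl -!(F2incD char2).
  rewrite !linearDr /= (F2_form_sym B u w) (F2_form_sym B v u) (F2_form_sym B w v).
  rewrite (_ : _ + _ + _ = 0) ?F2inc0 ?scale0r //.
  have [-> | ->] := F2_cases (B v w); have [-> | ->] := F2_cases (B u v);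
    have [-> | ->] := F2_cases (B w u); exact: val_inj.
Qed.

Hypothesis B_nondeg : nondegenerate B.

Lemma nondegenerate_partner u : u != 0 -> exists v, B u v = 1.
Proof.
move=> u_neq0; have : u \notin orthov B fullv.
  by rewrite (eqP B_nondeg) memv0.
case/mem_orthovPn=> v _ Buv; exists v.
by have [B0 | //] := F2_cases (B u v); rewrite B0 eqxx in Buv.
Qed.

(** If z is central and B u v = 1, the coefficient of [z, e_v] at u + v is that
    of z at u. *)
Lemma kap4_center : is_center mu <[e 0%R]>%VS.
Proof.
move=> z; split=> [/vlineP[a ->] x | z_ctr].
  have [b ->] := kap4_span x.
  rewrite (bilinear_sumr kap4_bilinear) big1 // => u _.
  by rewrite (bilinearZl kap4_bilinear) kap4_basis linear0l F2inc0 !(scale0r, scaler0).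
have z0 u : val u != 0 -> z u = 0.
  move=> /nondegenerate_partner[v Buv].
  pose uv : {w : T | w \in [set: T]} := Sub (val u + v) (in_setT _).
  have /(congr1 (fun f : kap_space K [set: T] => f uv)) := z_ctr (e v).
  rewrite {1}[z]kap_sum_basis (bilinear_suml kap4_bilinear) sum_ffunE !ffunE.
  rewrite (bigD1 u) //= kap4_basis Buv F2inc1 scale1r !ffunE SubK eqxx.
  rewrite big1 ?addr0 => [|w /negbTE neq_wu].
    by rewrite /GRing.scale /= mulr1.
  rewrite kap4_basis !ffunE SubK (inj_eq (addIr v)) val_eqE eq_sym neq_wu.
  by rewrite !scaler0.
apply/vlineP; exists (z (Sub 0 (in_setT _))).
rewrite {1}[z]kap_sum_basis (bigD1 (Sub 0 (in_setT _))) //= big1 ?addr0 // => u.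
by rewrite -val_eqE SubK => /z0 ->; rewrite scale0r.
Qed.

Local Notation T0 := [set~ (0 : T)].
Local Notation iota := (@kap_extend K V T0 _ e).

Lemma kap2_inclusion_val (f : kap_space K T0) u :
  iota f (Sub (val u) (in_setT (val u))) = f u.
Proof.
rewrite /kap_extend sum_ffunE (bigD1 u) //= !ffunE !SubK eqxx.
rewrite big1 ?addr0 => [|v]; first by rewrite /GRing.scale /= mulr1.
by rewrite -val_eqE !ffunE !SubK eq_sym => /negbTE ->; rewrite scaler0.
Qed.

Lemma kap2_inclusion_0 (f : kap_space K T0) : iota f (Sub 0 (in_setT 0)) = 0.
Proof.
rewrite /kap_extend sum_ffunE big1 // => v _; rewrite !ffunE SubK.
by have := valP v; rewrite !inE eq_sym => /negbTE ->; rewrite scaler0.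
Qed.

(** Two distinct vectors never add up to 0, so deleting e_0 leaves a
    subalgebra. *)
Lemma kap2_inclusion_morph f g : iota (kap2 K B f g) = mu (iota f) (iota g).
Proof.
apply: (kap_extend_morph kap4_bilinear) => u v _ _.
rewrite kap4_basis /kap_basis_bracket.
have [-> | neq_uv] /= := eqVneq u v; first by rewrite linear0 B_alt F2inc0 scale0r.
have uv_nz : u + v \in T0.
  rewrite !inE; apply: contra neq_uv => /eqP uv0.
  by rewrite -[u]addr0 -[X in _ + X](F2_vect_add2 v) addrA uv0 add0r.
by rewrite uv_nz linearZ /= kap_extend_basis.
Qed.

Definition kap4_join (xc : (kap_space K T0 * subvs_of <[e 0%R]>%VS)%type) :
    kap_space K [set: T] :=
  iota xc.1 + vsval xc.2.

Lemma kap4_join_is_linear : linear kap4_join.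
Proof.
by move=> a x y; rewrite /kap4_join /= !linearP /= scalerDr addrACA.
Qed.

HB.instance Definition _ :=
  GRing.isLinear.Build K _ _ *:%R kap4_join kap4_join_is_linear.

Lemma kap4_join_bij : bijective kap4_join.
Proof.
pose restr (f : kap_space K [set: T]) : kap_space K T0 :=
  [ffun u => f (Sub (val u) (in_setT _))].
pose f0 (f : kap_space K [set: T]) : K := f (Sub 0 (in_setT 0)).
exists (fun f => (restr f, vsproj <[e 0%R]>%VS (f0 f *: e 0))) => [[x y] | f].
  have /vlineP[a y_e0] := subvsP y; rewrite /kap4_join /=; congr (_, _).
    apply: kapP => u; rewrite !ffunE /= y_e0 kap2_inclusion_val !ffunE SubK.
    by have := valP u; rewrite !inE => /negbTE ->; rewrite scaler0 addr0.
  apply: val_inj; rewrite /= vsprojK ?memvZ ?memv_line // y_e0; congr (_ *: _).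
  by rewrite /f0 !ffunE kap2_inclusion_0 SubK eqxx /GRing.scale /= mulr1 add0r.
rewrite /kap4_join /= vsprojK ?memvZ ?memv_line //; apply: kapP => u.
have -> : u = Sub (val u) (in_setT _) by apply: val_inj; rewrite SubK.
rewrite !ffunE SubK; have [u0 | u_nz] := eqVneq (val u) 0.
  by rewrite u0 kap2_inclusion_0 add0r /GRing.scale /= mulr1.
have uT0 : val u \in T0 by rewrite !inE.
have := kap2_inclusion_val (restr f) (Sub (val u) uT0).
by rewrite scaler0 addr0 !ffunE SubK => ->.
Qed.

Lemma kap4_split :
  lie_isomorphic mu (sum_bracket (kap2 K B) (@sub_bracket _ _ mu <[e 0%R]>%VS)).
Proof.
have joinM x y :
  kap4_join (sum_bracket (kap2 K B) (@sub_bracket _ _ mu <[e 0%R]>%VS) x y)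
  = mu (kap4_join x) (kap4_join y).
  have [_ alt _] := kap4_lie.
  have ctr_l (c : subvs_of <[e 0%R]>%VS) f : mu (vsval c) f = 0.
    exact: (kap4_center _).1 (subvsP c) f.
  have ctr_r (c : subvs_of <[e 0%R]>%VS) f : mu f (vsval c) = 0.
    have := alt (f + vsval c); rewrite (bilinearDl kap4_bilinear).
    by rewrite !(bilinearDr kap4_bilinear) !alt ctr_l !(add0r, addr0).
  rewrite /kap4_join /sum_bracket /= kap2_inclusion_morph /sub_bracket.
  rewrite ctr_l !linear0 addr0 (bilinearDl kap4_bilinear).
  by rewrite !(bilinearDr kap4_bilinear) !ctr_l ctr_r !addr0.
apply: lie_isomorphic_sym; split; last by exists kap4_join; first exact: kap4_join_bij.
  apply: (@lie_bracket_pullback _ _ _ _ mu kap4_join _ joinM kap4_lie).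
  exact: bij_inj kap4_join_bij.
exact: kap4_lie.
Qed.

End Kap4.

(** * Symplectic bases over the field of two elements *)

Definition dual_index (I : Type) (j : I + I) : I + I :=
  match j with inl i => inr i | inr i => inl i end.

Lemma dual_indexK (I : Type) : involutive (@dual_index I).
Proof. by case. Qed.

Section Symplectic.
Variables (V : vectType 'F_2) (B : {skew_symmetric V}).
Hypothesis B_alt : forall v : V, B v v = 0.
Hypothesis B_nondeg : nondegenerate B.

(** The indices [inl i] and [inr i] label the two vectors of a hyperbolic pair. *)
Definition symplectic (I : finType) (b : I + I -> V) :=
  forall i j, B (b i) (b j) = (j == dual_index i)%:R.

Definition pairings (I : finType) (b : I + I -> V) (v : V) :
    {ffun I + I -> ('F_2)^o} :=
  [ffun j => B v (b j)].

Lemma pairings_is_linear I b : linear (@pairings I b).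
Proof. by move=> a u v; apply/ffunP=> j; rewrite !ffunE linearPl. Qed.

HB.instance Definition _ I b :=
  GRing.isLinear.Build 'F_2 V _ *:%R (@pairings I b) (@pairings_is_linear I b).

Lemma pairings_sum (I : finType) (b : I + I -> V) (c : I + I -> 'F_2) l :
  symplectic b -> B (\sum_j c j *: b j) (b l) = c (dual_index l).
Proof.
move=> b_symp; rewrite linear_sumlz (bigD1 (dual_index l)) //=.
rewrite linearZl_LR /= b_symp dual_indexK eqxx mulr1 big1 ?addr0 // => j neq_jl.
rewrite linearZl_LR /= b_symp (_ : l == _ = false) ?mulr0 //.
by apply/negbTE; apply: contra neq_jl => /eqP ->; rewrite dual_indexK.
Qed.

(** Fewer than \dim V pairings leave a nonzero vector w orthogonal to the family;
    a partner of w, corrected by a combination of the family, completes a new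
    hyperbolic pair. *)
Lemma symplectic_extend (I : finType) (b : I + I -> V) :
  (#|{: I + I}| < \dim {: V})%N -> symplectic b ->
  exists b' : option I + option I -> V, symplectic b'.
Proof.
move=> lt_dim b_symp; pose c := linfun (@pairings I b).
have : lker c != 0%VS.
  rewrite -dimv_eq0 -lt0n -[lker c]capfv.
  rewrite -(ltn_add2r (\dim (limg c))) limg_ker_dim add0n.
  apply: leq_ltn_trans lt_dim; rewrite -(dim_ffun 'F_2 (I + I)%type).
  exact: dimvS (subvf _).
rewrite -vpick0; set w := vpick _ => w_neq0.
have wb j : B w (b j) = 0.
  have : w \in lker c by apply: memv_pick.
  by rewrite memv_ker lfunE => /eqP/ffunP/(_ j); rewrite !ffunE.
have [z0 wz0] := nondegenerate_partner B_nondeg w_neq0.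
pose z := z0 + \sum_j B z0 (b (dual_index j)) *: b j.
have wz : B w z = 1.
  rewrite linearDr /= wz0 linear_sumr big1 ?addr0 // => j _.
  by rewrite linearZr_LR /= wb mulr0.
have zb j : B z (b j) = 0.
  by rewrite linearDl /= pairings_sum // dual_indexK (F2_vect_add2 (_ : ('F_2)^o)).
pose b' (j : option I + option I) := match j with
  | inl (Some i) => b (inl i) | inr (Some i) => b (inr i)
  | inl None => w | inr None => z end.
have bw j : B (b j) w = 0 by rewrite F2_form_sym.
have bz j : B (b j) z = 0 by rewrite F2_form_sym.
have zw : B z w = 1 by rewrite F2_form_sym.
exists b' => -[[i|]|[i|]] [[j|]|[j|]] //=; rewrite ?b_symp ?B_alt //.
Qed.

Lemma symplectic_reindex (I J : finType) (b : I + I -> V) (h : J -> I) :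
  injective h -> symplectic b ->
  symplectic (fun j => b (match j with inl i => inl (h i) | inr i => inr (h i) end)).
Proof.
move=> h_inj b_symp [i|i] [j|j]; rewrite b_symp //=; congr (_%:R).
- by rewrite /eq_op /= (inj_eq h_inj).
- by rewrite /eq_op /= (inj_eq h_inj).
Qed.

Lemma symplectic_family k :
  (2 * k <= \dim {: V})%N -> exists b : 'I_k + 'I_k -> V, symplectic b.
Proof.
elim: k => [_ | k IHk le_k].
  by exists (fun=> 0) => -[[]|[]].
have lt_k : (2 * k < \dim {: V})%N by apply: leq_trans le_k; rewrite ltn_pmul2l.
have [|b' b'_symp] := IHk _; first exact: ltnW.
have [|b b_symp] := symplectic_extend _ b'_symp.
  by rewrite card_sum card_ord addnn -mul2n.
eexists; apply: (symplectic_reindex (h := unlift ord0) _ b_symp) => i j.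
by case: unliftP => [i'|] ->; case: unliftP => [j'|] -> // [->].
Qed.

(** The pairings with a symplectic family of full size map V onto the space of
    coordinates, hence bijectively, and they take the same values on both sides. *)
Lemma symplectic_coordinates (I : finType) (b : I + I -> V) v :
  \dim {: V} = #|{: I + I}| -> symplectic b ->
  v = \sum_j B v (b (dual_index j)) *: b j.
Proof.
move=> dimV b_symp.
have c_bij : bijective (@pairings I b).
  apply: surjective_bij; first by rewrite dim_ffun.
  apply/eqP; rewrite eqEsubv subvf; apply/subvP => y _; apply/memv_imgP.
  exists (\sum_j y (dual_index j) *: b j); rewrite ?memvf // lfunE.
  by apply/ffunP => l; rewrite ffunE pairings_sum // dual_indexK.
apply: (bij_inj c_bij); apply/ffunP => l; rewrite !ffunE.
by rewrite pairings_sum // dual_indexK.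
Qed.

Lemma symplectic_formE (I : finType) (b : I + I -> V) u v :
  \dim {: V} = #|{: I + I}| -> symplectic b ->
  B u v = \sum_j B u (b (dual_index j)) * B v (b j).
Proof.
move=> dimV b_symp; rewrite {1}(symplectic_coordinates u dimV b_symp).
rewrite linear_sumlz /=; apply: eq_bigr => j _.
by rewrite linearZl_LR /= (F2_form_sym B (b j)).
Qed.

End Symplectic.

(** * Truncated polynomials: derivations and Poisson brackets *)

Section Derivations.
Variables (K : fieldType) (I : finType).
Local Notation O := (tpoly K I).
Hypothesis char2 : 2%N \in [pchar K].

Lemma tpoly_deriv1 (i : I) : tpoly_deriv i (1 : O) = 0.
Proof. by rewrite -(tpoly_mon0 K I) tpoly_deriv_mon inE. Qed.

Lemma tpoly_deriv_var (i j : I) : tpoly_deriv i (tpoly_var K j) = (i == j)%:R.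
Proof.
rewrite tpoly_deriv_mon inE; case: eqVneq => // ->.
by rewrite setDv tpoly_mon0.
Qed.

(** The relation x_i ^ 2 = 0 is preserved by the derivation because 2 = 0: when
    i lies in both monomials, the two terms of the Leibniz rule coincide. *)
Lemma tpoly_deriv_mon_mul i (S T : {set I}) :
  tpoly_deriv i (tpoly_mon K S * tpoly_mon K T)
  = tpoly_deriv i (tpoly_mon K S) * tpoly_mon K T
    + tpoly_mon K S * tpoly_deriv i (tpoly_mon K T).
Proof.
have one_side (A C : {set I}) : i \in A -> i \notin C ->
    tpoly_deriv i (tpoly_mon K A * tpoly_mon K C)
    = tpoly_deriv i (tpoly_mon K A) * tpoly_mon K C.
  move=> iA niC; rewrite tpoly_deriv_mon iA !tpoly_mon_mul.
  have -> : [disjoint A :\ i & C] = [disjoint A & C].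
    rewrite -!setI_eq0; congr (_ == _); apply/setP=> j; rewrite !inE.
    by case: eqVneq => [->|] //=; rewrite (negbTE niC) andbF.
  case: ifP => _; last exact: linear0.
  rewrite tpoly_deriv_mon inE iA /= setDUl; congr (tpoly_mon K (_ :|: _)).
  by apply/setDidPl; rewrite disjoint_sym disjoints1.
have [iS | niS] := boolP (i \in S); have [iT | niT] := boolP (i \in T).
- rewrite !tpoly_deriv_mon iS iT !tpoly_mon_mul.
  have -> : [disjoint S & T] = false.
    by apply/negbTE/pred0Pn; exists i; rewrite /= iS iT.
  have -> : [disjoint S :\ i & T] = [disjoint S & T :\ i].
    by rewrite -!setI_eq0 setIDA setIDAC.
  have -> : S :\ i :|: T = S :|: T :\ i.
    apply/setP=> j; rewrite !inE; case: eqVneq => [->|] //=.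
    by rewrite iS iT.
  by rewrite linear0 pchar2_add_self.
- rewrite one_side // [tpoly_deriv i (tpoly_mon K T)]tpoly_deriv_mon.
  by rewrite (negbTE niT) mulr0 addr0.
- rewrite mulrC one_side // [tpoly_deriv i (tpoly_mon K S)]tpoly_deriv_mon.
  by rewrite (negbTE niS) mul0r add0r mulrC.
- rewrite tpoly_mon_mul !tpoly_deriv_mon (negbTE niS) (negbTE niT) mulr0 mul0r addr0.
  case: ifP => _; rewrite ?linear0 // tpoly_deriv_mon.
  by rewrite inE (negbTE niS) (negbTE niT).
Qed.

Lemma tpoly_derivM i (f g : O) :
  tpoly_deriv i (f * g) = tpoly_deriv i f * g + f * tpoly_deriv i g.
Proof.
rewrite (tpoly_sum_mon f) mulr_suml !linear_sum !mulr_suml -big_split.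
apply: eq_bigr => S _; rewrite /= -!scalerAl !linearZ /= -!scalerAl -scalerDr.
congr (_ *: _); rewrite (tpoly_sum_mon g) mulr_sumr !linear_sum !mulr_sumr.
rewrite -big_split.
apply: eq_bigr => T _; rewrite /= -!scalerAr !linearZ /= -!scalerAr -scalerDr.
by rewrite tpoly_deriv_mon_mul.
Qed.

End Derivations.

Section Bracket.
Variables (K : fieldType) (m : nat).
Hypothesis char2 : 2%N \in [pchar K].
Local Notation O := (Oalg K m).
Implicit Types (f g h : O).

(** By conversion this is [log_bracket] for [w i] = (1 + p_i)(1 + q_i) and
    [hbar_bracket] for [w i] = 1 + hbar p_i q_i. *)
Definition weighted_bracket (w : 'I_m -> O) f g : O :=
  \sum_(i < m) w i * (dp i f * dq i g + dq i f * dp i g).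

Variable w : 'I_m -> O.
Local Notation mu := (weighted_bracket w).

Lemma weighted_bracketC f g : mu f g = mu g f.
Proof.
apply: eq_bigr => i _; congr (_ * _).
by rewrite addrC [dq i f * _]mulrC [dp i f * _]mulrC.
Qed.

Lemma weighted_bracket_alternating : alternating mu.
Proof.
move=> f; rewrite /weighted_bracket big1 // => i _.
by rewrite [dp i f * _]mulrC pchar2_add_self // mulr0.
Qed.

Lemma weighted_bracket_linear f : linear (mu^~ f).
Proof.
move=> a g h; rewrite /weighted_bracket scaler_sumr -big_split /=.
apply: eq_bigr => i _; rewrite /dp /dq !linearP /= !mulrDl -!scalerAl.
by rewrite addrACA -scalerDr mulrDr -scalerAr.
Qed.

Lemma weighted_bracket_bilinear : bilinear_for *:%R *:%R mu.
Proof.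
split=> [f | f a g h]; first exact: weighted_bracket_linear.
by rewrite ![mu f _]weighted_bracketC weighted_bracket_linear.
Qed.

Lemma weighted_bracketMl f g h : mu (f * g) h = mu f h * g + f * mu g h.
Proof.
rewrite /weighted_bracket mulr_suml mulr_sumr -big_split /=.
apply: eq_bigr => i _; rewrite /dp /dq !tpoly_derivM //; ring.
Qed.

Lemma weighted_bracket1l h : mu 1 h = 0.
Proof.
rewrite /weighted_bracket big1 // => i _.
by rewrite /dp /dq !tpoly_deriv1 !mul0r addr0 mulr0.
Qed.

(** Logarithmic derivative of a product of involutions y_j, for which
    y_j^-1 = y_j. *)
Lemma weighted_bracket_prodl (J : Type) (r : seq J) (y : J -> O) h :
  (forall j, y j * y j = 1) ->
  mu (\prod_(j <- r) y j) h
  = (\prod_(j <- r) y j) * \sum_(j <- r) y j * mu (y j) h.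
Proof.
move=> yy; elim: r => [|j r IHr]; first by rewrite !big_nil weighted_bracket1l mulr0.
rewrite !big_cons weighted_bracketMl IHr.
rewrite -[X in X * _ + _]mulr1 -[X in _ * X * _ + _](yy j); ring.
Qed.

End Bracket.

(** * Exponentials of log-canonical coordinates *)

Section Exponential.
Variables (K : fieldType) (m : nat) (V : vectType 'F_2) (B : {skew_symmetric V}).
Hypothesis char2 : 2%N \in [pchar K].
Hypothesis B_alt : forall v : V, B v v = 0.
Hypothesis dimV : \dim {: V} = (2 * m)%N.
Local Notation O := (Oalg K m).
Local Notation I := ('I_m + 'I_m)%type.

(** [A] ranges over the subalgebras of the truncated polynomials. *)
Definition generates (z : I -> O) := forall A : {vspace O},
  1 \in A -> {in A &, forall f g, f * g \in A} -> (forall j, z j \in A) ->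
  A = fullv.

(** The logarithms of the [z j] formally satisfy the canonical commutation
    relations up to the factor [kappa]. *)
Definition log_canonical (mu : O -> O -> O) (kappa : K) (z : I -> O) :=
  forall j k, mu (z j) (z k)
              = if k == dual_index j then kappa *: (z j * z k) else 0.

Variables (w : 'I_m -> O) (kappa : K) (z : I -> O) (b : I -> V).
Local Notation mu := (weighted_bracket w).
Hypothesis kappa_neq0 : kappa != 0.
Hypothesis z_sqr : forall j, z j * z j = 1.
Hypothesis z_log : log_canonical mu kappa z.
Hypothesis z_gen : generates z.
Hypothesis b_symp : symplectic B b.

Local Notation coord u j := (B u (b (dual_index j))).

Lemma F2_power_sqr (a : 'F_2) j : z j ^+ (a != 0) * z j ^+ (a != 0) = 1.
Proof. by case: (a != 0); rewrite ?z_sqr ?mulr1. Qed.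

Definition exponential (u : V) : O := \prod_j z j ^+ (coord u j != 0).

Lemma exponentialD u v : exponential (u + v) = exponential u * exponential v.
Proof.
rewrite /exponential -big_split; apply: eq_bigr => j _ /=.
rewrite linearDl /=; have [-> | ->] := F2_cases (coord u j).
  by rewrite add0r eqxx mul1r.
have [-> | ->] := F2_cases (coord v j); first by rewrite addr0 mulr1.
by rewrite (_ : 1 + 1 = 0) ?z_sqr; last exact: val_inj.
Qed.

Lemma exponential0 : exponential 0 = 1.
Proof. by rewrite /exponential big1 // => j _; rewrite linear0l eqxx. Qed.

Lemma exponential_basis j : exponential (b j) = z j.
Proof.
rewrite /exponential (bigD1 j) //= b_symp eqxx expr1 big1 ?mulr1 // => l neq_lj.
by rewrite b_symp (can_eq (@dual_indexK _)) (negbTE neq_lj) eqxx.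
Qed.

(** The logarithmic derivative is additive in the exponent. *)
Lemma exponential_bracketl u h :
  mu (exponential u) h
  = exponential u * \sum_j F2inc K (coord u j) *: (z j * mu (z j) h).
Proof.
rewrite weighted_bracket_prodl // => [|j]; last exact: F2_power_sqr.
congr (_ * _); apply: eq_bigr => j _.
have [-> | ->] := F2_cases (coord u j); last by rewrite F2inc1 scale1r expr1.
by rewrite eqxx expr0 mul1r weighted_bracket1l F2inc0 scale0r.
Qed.

(** Taking logarithmic derivatives in both arguments turns the bracket into the
    bilinear form of the coordinates of u and v, which is B itself. *)
Lemma exponential_bracket u v :
  mu (exponential u) (exponential v)
  = (kappa * F2inc K (B u v)) *: exponential (u + v).
Proof.
rewrite exponentialD exponential_bracketl scalerAr; congr (_ * _).
have dimVI : \dim {: V} = #|{: I}| by rewrite dimV card_sum card_ord addnn mul2n.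
rewrite (symplectic_formE u v dimVI b_symp) F2inc_sum // mulr_sumr scaler_suml.
apply: eq_bigr => j _; rewrite F2incM.
rewrite weighted_bracketC exponential_bracketl (bigD1 (dual_index j)) //=.
rewrite big1 => [|k neq_kj].
  rewrite addr0 dual_indexK weighted_bracketC z_log eqxx.
  rewrite mulrA [X in X * _]mulrC -!scalerAr.
  rewrite [X in _ *: (_ *: X)](_ : _ = exponential v); last first.
    (* The squares of z_j and of its partner are 1 and can be inserted. *)
    transitivity ((z j * z j) * (z (dual_index j) * z (dual_index j)) * exponential v).
      by ring.
    by rewrite !z_sqr !mul1r.
  by rewrite !scalerA; congr (_ *: _); ring.
rewrite weighted_bracketC z_log (negbTE neq_kj) !(mulr0, scaler0) //.
Qed.

(** The factor [kappa^-1], which occurs once in the image of a bracket and twice in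
    the bracket of the images, absorbs the constant [kappa]. *)
Definition scaled_exponential (u : finvect_type V) : O :=
  kappa^-1 *: exponential u.

Local Notation phi := (@kap_extend K V [set: finvect_type V] O scaled_exponential).

Lemma scaled_exponential_morph f g : phi (kap4 K B f g) = mu (phi f) (phi g).
Proof.
apply: (kap_extend_morph (weighted_bracket_bilinear w)) => u v _ _.
rewrite kap4_basis_bracketE // linearZ /= kap_extend_basis ?in_setT //.
have bil := weighted_bracket_bilinear w.
rewrite /scaled_exponential (bilinearZl bil) (bilinearZr bil) exponential_bracket.
by rewrite !scalerA; congr (_ *: _); field.
Qed.

(** Exponentials multiply among themselves, so the image is a subalgebra; it
    contains the generators [z j], and both sides have dimension 2 ^ (2 m). *)
Lemma scaled_exponential_bij : bijective phi.
Proof.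
apply: surjective_bij.
  rewrite [LHS]dim_ffun [RHS]dim_ffun -[RHS]cardsT -powersetT card_powerset.
  rewrite cardsT card_sum card_ord addnn -mul2n -dimV card_sig.
  have := card_vspace (fullv : {vspace finvect_type V}).
  rewrite card_Fp // => <-; apply: eq_card => u.
  by rewrite !inE memvf.
have expA u : exponential u \in limg (linfun phi).
  apply/memv_imgP; exists (kappa *: kap_basis K [set: finvect_type V] u).
    exact: memvf.
  rewrite lfunE /= linearZ /= kap_extend_basis ?in_setT //.
  by rewrite scalerA divff // scale1r.
apply: z_gen => [|f g|j]; last by rewrite -exponential_basis.
  by rewrite -exponential0.
case/memv_imgP=> x _ ->; case/memv_imgP=> y _ ->; rewrite !lfunE /=.
rewrite /kap_extend mulr_suml memv_suml // => u _.
rewrite mulr_sumr memv_suml // => v _.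
rewrite /scaled_exponential -!(scalerAl, scalerAr) !memvZ //.
by rewrite -exponentialD.
Qed.

End Exponential.

(** * The two brackets as exponentials *)

Section Realizations.
Variables (K : fieldType) (m : nat).
Hypothesis char2 : 2%N \in [pchar K].
Local Notation O := (Oalg K m).
Local Notation I := ('I_m + 'I_m)%type.

Lemma vars_generate : generates (fun j : I => tpoly_var K j).
Proof.
move=> A A1 AM Az; apply/eqP; rewrite eqEsubv subvf; apply/subvP=> f _.
rewrite (tpoly_sum_mon f) memv_suml // => S _; apply: memvZ.
by rewrite tpoly_monE; apply: (big_ind (fun g => g \in A)).
Qed.

Definition index_pair (j : I) : 'I_m := match j with inl i => i | inr i => i end.

(** Coordinates that are separated along the hyperbolic pairs are log-canonical
    as soon as this holds inside each pair. *)
Lemma log_canonical_separated (w : 'I_m -> O) kappa (z : I -> O) :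
  (forall i j, index_pair j != i -> dp i (z j) = 0 /\ dq i (z j) = 0) ->
  (forall i, w i * (dp i (z (inl i)) * dq i (z (inr i))
                    + dq i (z (inl i)) * dp i (z (inr i)))
             = kappa *: (z (inl i) * z (inr i))) ->
  log_canonical (weighted_bracket w) kappa z.
Proof.
move=> z_sep z_pair.
have diff_pair j k : index_pair j != index_pair k ->
    weighted_bracket w (z j) (z k) = 0.
  move=> neq_jk; rewrite /weighted_bracket big1 // => i _.
  have [eq_ji | /z_sep[-> ->]] := eqVneq (index_pair j) i.
    have /z_sep[-> ->] : index_pair k != i by rewrite -eq_ji eq_sym.
    by rewrite !mulr0 addr0 mulr0.
  by rewrite !mul0r addr0 mulr0.
have same_pair i :
    weighted_bracket w (z (inl i)) (z (inr i)) = kappa *: (z (inl i) * z (inr i)).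
  rewrite -z_pair /weighted_bracket (bigD1 i) //= big1 ?addr0 // => i' neq_i'.
  have /z_sep[-> ->] : index_pair (inl i) != i' by rewrite eq_sym.
  by rewrite !mul0r addr0 mulr0.
have alt := weighted_bracket_alternating char2 w.
case=> i [k|k] /=; rewrite /eq_op /=.
- by have [<- | neq_ik] := eqVneq i k; rewrite ?alt ?diff_pair.
- have [<- | neq_ik] := eqVneq i k; first by rewrite same_pair.
  by rewrite diff_pair.
- have [<- | neq_ik] := eqVneq i k.
    by rewrite weighted_bracketC same_pair mulrC.
  by rewrite diff_pair.
- by have [<- | neq_ik] := eqVneq i k; rewrite ?alt ?diff_pair.
Qed.

Lemma dp_pvar (i k : 'I_m) : dp i (pvar K k) = (i == k)%:R.
Proof. exact: tpoly_deriv_var. Qed.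
Lemma dp_qvar (i k : 'I_m) : dp i (qvar K k) = 0.
Proof. exact: tpoly_deriv_var. Qed.
Lemma dq_pvar (i k : 'I_m) : dq i (pvar K k) = 0.
Proof. exact: tpoly_deriv_var. Qed.
Lemma dq_qvar (i k : 'I_m) : dq i (qvar K k) = (i == k)%:R.
Proof. exact: tpoly_deriv_var. Qed.

Lemma pvar_sqr (i : 'I_m) : pvar K i ^+ 2 = 0. Proof. exact: tpoly_var_sqr. Qed.
Lemma qvar_sqr (i : 'I_m) : qvar K i ^+ 2 = 0. Proof. exact: tpoly_var_sqr. Qed.

Lemma tpoly_2 : 2 = 0 :> O.
Proof. by rewrite -(pchar2_add_self char2 (1 : O)). Qed.

Definition log_coord (j : I) : O := 1 + tpoly_var K j.

Lemma log_coord_sqr j : log_coord j * log_coord j = 1.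
Proof.
transitivity (1 + 2 * tpoly_var K j + tpoly_var K j ^+ 2).
  by rewrite /log_coord; ring.
by rewrite tpoly_2 tpoly_var_sqr mul0r !addr0.
Qed.

Lemma log_coord_canonical : log_canonical (log_bracket K m) 1 log_coord.
Proof.
have dp1 i j : dp i (log_coord j) = (inl i == j)%:R.
  by rewrite /dp /log_coord linearD /= tpoly_deriv1 tpoly_deriv_var add0r.
have dq1 i j : dq i (log_coord j) = (inr i == j)%:R.
  by rewrite /dq /log_coord linearD /= tpoly_deriv1 tpoly_deriv_var add0r.
apply: log_canonical_separated => [i [k|k] /negbTE neq_ki | i].
- by rewrite dp1 dq1 /eq_op /= eq_sym neq_ki.
- by rewrite dp1 dq1 /eq_op /= eq_sym neq_ki.
- by rewrite !dp1 !dq1 !eqxx /= mulr0 addr0 !mulr1 scale1r.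
Qed.

Lemma log_coord_generates : generates log_coord.
Proof.
move=> A A1 AM Az; apply: vars_generate => // j.
have -> : tpoly_var K j = log_coord j - 1 by rewrite /log_coord; ring.
exact: memvB.
Qed.

Variable hbar : K.
Hypothesis hbar_neq0 : hbar != 0.

(** For m = 1 the equation (1 + hbar p q) {x, y} = hbar x y for x, y with constant
    term 1 and x ^ 2 = y ^ 2 = 1 is solved by these elements, whose linear parts
    are hbar p and q. *)
Definition hbar_coord (j : I) : O :=
  match j with
  | inl i => 1 + hbar%:A * pvar K i + hbar%:A * (pvar K i * qvar K i)
  | inr i => 1 + qvar K i + hbar%:A * (pvar K i * qvar K i)
  end.

Lemma hbar_coord_sqr j : hbar_coord j * hbar_coord j = 1.
Proof.
case: j => i /=; set h := hbar%:A; set p := pvar K i; set q := qvar K i.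
  transitivity (1 + 2 * (h * p + h * p * q) + p ^+ 2 * (h + h * q) ^+ 2).
    by ring.
  by rewrite pvar_sqr tpoly_2 !mul0r !addr0.
transitivity (1 + 2 * (q + h * p * q) + q ^+ 2 * (1 + h * p) ^+ 2); first by ring.
by rewrite qvar_sqr tpoly_2 !mul0r !addr0.
Qed.

Lemma dp_hbar_coord i j :
  dp i (hbar_coord j) = match j with
    | inl k => (i == k)%:R * (hbar%:A * (1 + qvar K k))
    | inr k => (i == k)%:R * (hbar%:A * qvar K k) end.
Proof.
have D1 : dp i (1 : O) = 0 by exact: tpoly_deriv1.
have DD f g : dp i (f + g : O) = dp i f + dp i g by exact: linearD.
have DZ f : dp i (hbar%:A * f : O) = hbar%:A * dp i f.
  by rewrite /dp !mulr_algl linearZ.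
have DM f g : dp i (f * g : O) = dp i f * g + f * dp i g by exact: tpoly_derivM.
by case: j => k; rewrite /= !(DD, DZ, DM, D1, dp_pvar, dp_qvar); ring.
Qed.

Lemma dq_hbar_coord i j :
  dq i (hbar_coord j) = match j with
    | inl k => (i == k)%:R * (hbar%:A * pvar K k)
    | inr k => (i == k)%:R * (1 + hbar%:A * pvar K k) end.
Proof.
have D1 : dq i (1 : O) = 0 by exact: tpoly_deriv1.
have DD f g : dq i (f + g : O) = dq i f + dq i g by exact: linearD.
have DZ f : dq i (hbar%:A * f : O) = hbar%:A * dq i f.
  by rewrite /dq !mulr_algl linearZ.
have DM f g : dq i (f * g : O) = dq i f * g + f * dq i g by exact: tpoly_derivM.
by case: j => k; rewrite /= !(DD, DZ, DM, D1, dq_pvar, dq_qvar); ring.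
Qed.

Lemma hbar_coord_canonical : log_canonical (hbar_bracket K m hbar) hbar hbar_coord.
Proof.
apply: log_canonical_separated => [i [k|k] /negbTE neq_ki | i].
- by rewrite dp_hbar_coord dq_hbar_coord eq_sym neq_ki !mul0r.
- by rewrite dp_hbar_coord dq_hbar_coord eq_sym neq_ki !mul0r.
- rewrite !dp_hbar_coord !dq_hbar_coord !eqxx /= -[hbar *: (_ * _)]mulr_algl.
  rewrite -[hbar *: (_ * _)]mulr_algl.
  set h := hbar%:A; set p := pvar K i; set q := qvar K i.
  transitivity (h * ((1 + h * p + h * (p * q)) * (1 + q + h * (p * q)))
                + h ^+ 3 * q ^+ 2 * p ^+ 2); first by ring.
  by rewrite pvar_sqr mulr0 addr0.
Qed.

(** With P = x - 1 and Q = y - 1 one has P Q = hbar p q, hence hbar p = P - P Q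
    and q = Q - P Q. *)
Lemma hbar_coord_generates : generates hbar_coord.
Proof.
move=> A A1 AM Az; apply: vars_generate => //.
have AB f g : f \in A -> g \in A -> f - g \in A by exact: memvB.
pose P i := hbar_coord (inl i) - 1; pose Q i := hbar_coord (inr i) - 1.
have AP i : P i \in A by apply: AB.
have AQ i : Q i \in A by apply: AB.
have APQ i : P i * Q i \in A by exact: AM (AP i) (AQ i).
have PQ i : P i * Q i = hbar%:A * (pvar K i * qvar K i).
  rewrite /P /Q /=; set h := hbar%:A; set p := pvar K i; set q := qvar K i.
  transitivity (h * (p * q) + p ^+ 2 * (h ^+ 2 * q * (1 + q)) + q ^+ 2 * (h * p)).
    by ring.
  by rewrite pvar_sqr qvar_sqr !mul0r !addr0.
case=> i.
  have hp : P i - P i * Q i = hbar *: pvar K i.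
    by rewrite PQ /P /= -[RHS]mulr_algl; ring.
  have -> : tpoly_var K (inl i) = hbar^-1 *: (P i - P i * Q i).
    by rewrite hp scalerA mulVf // scale1r.
  exact: memvZ (AB _ _ (AP i) (APQ i)).
have -> : tpoly_var K (inr i) = Q i - P i * Q i.
  by rewrite PQ /Q /= -[LHS]/(qvar K i); ring.
exact: AB (AQ i) (APQ i).
Qed.

End Realizations.

(** * The deformation of the Poisson bracket *)

(** If p is nonzero then 'X * p - 1 is not constant and has a root h, for which
    h and p.[h] are both nonzero. *)
Lemma poly_eq0_punctured (K : closedFieldType) (p : {poly K}) :
  (forall t, t != 0 -> p.[t] = 0) -> p = 0.
Proof.
move=> p_root; apply/eqP/negPn/negP => p_neq0.
have size_Xp : size ('X * p) = (size p).+1 by rewrite mulrC size_mulX.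
have : size ('X * p - 1) != 1%N.
  rewrite size_polyDl size_Xp; first by rewrite eqSS size_poly_eq0.
  by rewrite size_polyN size_polyC oner_eq0 ltnS size_poly_gt0.
case/closed_rootP=> h; rewrite /root !hornerE subr_eq0 => /eqP hp1.
have [h0 | /p_root ph0] := eqVneq h 0; move/eqP: hp1.
  by rewrite h0 mul0r eq_sym oner_eq0.
by rewrite ph0 mulr0 eq_sym oner_eq0.
Qed.

Lemma tpoly_quadratic_eq0 (K : closedFieldType) (I : finType)
    (c0 c1 c2 : tpoly K I) :
  (forall t : K, t != 0 -> c0 + t *: c1 + t ^+ 2 *: c2 = 0) ->
  [/\ c0 = 0, c1 = 0 & c2 = 0].
Proof.
move=> c_eq0.
have Poly0 S : Poly [:: c0 S : K; c1 S : K; c2 S : K] = 0.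
  apply: poly_eq0_punctured => t /c_eq0/(congr1 (fun f : tpoly K I => f S)).
  rewrite !ffunE horner_Poly /= mul0r add0r => <-.
  by rewrite /GRing.scale /=; ring.
by split; apply: tpolyP => S; move/polyP: (Poly0 S);
  [move/(_ 0%N) | move/(_ 1%N) | move/(_ 2%N)]; rewrite coef_Poly coef0 ffunE /=.
Qed.

(** Polarized in the bracket, so as to expand the Jacobi identity of a pencil. *)
Definition jacobiator (K : fieldType) (L : lmodType K) (mu nu : L -> L -> L) x y z :=
  mu x (nu y z) + mu y (nu z x) + mu z (nu x y).

Lemma jacobiator_pencil (K : fieldType) (L : lmodType K) (mu nu pencil : L -> L -> L)
    t x y z :
  bilinear_for *:%R *:%R mu -> bilinear_for *:%R *:%R nu ->
  (forall f g, pencil f g = mu f g + t *: nu f g) ->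
  jacobiator pencil pencil x y z
  = jacobiator mu mu x y z + t *: (jacobiator mu nu x y z + jacobiator nu mu x y z)
    + t ^+ 2 *: jacobiator nu nu x y z.
Proof.
move=> mu_bil nu_bil pencil_def.
have pencilE f g h : pencil f (pencil g h)
    = mu f (mu g h) + t *: (mu f (nu g h) + nu f (mu g h)) + t ^+ 2 *: nu f (nu g h).
  rewrite !pencil_def (bilinearDr mu_bil) (bilinearDr nu_bil).
  rewrite (bilinearZr mu_bil) (bilinearZr nu_bil) !scalerDr scalerA -expr2.
  by rewrite !addrA.
rewrite /jacobiator !pencilE.
rewrite (addrACA _ (t ^+ 2 *: _)) -scalerDr (addrACA _ (t ^+ 2 *: _)) -scalerDr.
rewrite (addrACA _ (t *: _)) -scalerDr (addrACA _ (t *: _)) -scalerDr.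
by congr (_ + t *: _ + _); rewrite [RHS]addrACA; congr (_ + _); rewrite addrACA.
Qed.

Section Deformation.
Variables (K : closedFieldType) (m : nat).
Hypothesis char2 : 2%N \in [pchar K].
Local Notation O := (Oalg K m).

Definition pq_bracket : O -> O -> O :=
  weighted_bracket (fun i => pvar K i * qvar K i).

Lemma po_bracketE f g : po_bracket K m f g = weighted_bracket (fun=> 1) f g.
Proof. by apply: eq_bigr => i _; rewrite mul1r. Qed.

Lemma hbar_bracketE t f g :
  hbar_bracket K m t f g = po_bracket K m f g + t *: pq_bracket f g.
Proof.
rewrite po_bracketE /pq_bracket /weighted_bracket scaler_sumr -big_split.
by apply: eq_bigr => i _; rewrite /= mulrDl -scalerAl.
Qed.

Lemma po_bracket_bilinear : bilinear_for *:%R *:%R (po_bracket K m).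
Proof.
have [bil_l bil_r] := weighted_bracket_bilinear (fun=> 1 : O).
by split=> f a g h; rewrite !po_bracketE ?bil_l ?bil_r.
Qed.

Definition po_coefficient (k : nat) : O -> O -> O :=
  match k with 0 => po_bracket K m | 1 => pq_bracket | _ => fun _ _ => 0 end.

Lemma po_coefficient_bilinear k : bilinear_for *:%R *:%R (po_coefficient k).
Proof.
case: k => [|[|k]]; first exact: po_bracket_bilinear.
  exact: weighted_bracket_bilinear.
by split=> f a g h; rewrite /= scaler0 addr0.
Qed.

(** The three coefficients of the Jacobiator of hbar_bracket t are obtained
    together: a quadratic polynomial in t that vanishes for every t != 0 is 0. *)
Lemma hbar_formal :
  (forall t : K, t != 0 -> jacobi (hbar_bracket K m t)) ->
  formal_lie_bracket po_coefficient.
Proof.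
move=> jac; split; first exact: po_coefficient_bilinear.
  move=> [|[|k]] f //=; last exact: weighted_bracket_alternating.
  by rewrite po_bracketE weighted_bracket_alternating.
move=> n x y z.
pose J i j := jacobiator (po_coefficient i) (po_coefficient j) x y z.
have bil := po_coefficient_bilinear.
have bil0 : bilinear_for *:%R *:%R (po_bracket K m) by exact: (bil 0%N).
have bil1 : bilinear_for *:%R *:%R pq_bracket by exact: (bil 1%N).
have [J0 J1 J2] : [/\ J 0%N 0%N = 0, J 0%N 1%N + J 1%N 0%N = 0 & J 1%N 1%N = 0].
  apply: tpoly_quadratic_eq0 => t t_neq0; rewrite -[RHS](jac t t_neq0 x y z).
  exact/esym/(jacobiator_pencil x y z bil0 bil1 (hbar_bracketE t)).
have J_ge2 i j : (1 < i)%N || (1 < j)%N -> J i j = 0.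
  rewrite /J /jacobiator; case: i => [|[|i]]; case: j => [|[|j]] //= _;
    by rewrite ?(bilinear0r bil0) ?(bilinear0r bil1) !addr0.
rewrite -[LHS]/(\sum_(i < n.+1) J i (n - i)%N).
case: n => [|[|[|n]]].
- by rewrite big_ord1.
- by rewrite !big_ord_recl big_ord0 addr0.
- transitivity (J 0%N 2%N + (J 1%N 1%N + J 2%N 0%N)).
    by rewrite !big_ord_recl big_ord0 addr0.
  by rewrite [J 0%N _]J_ge2 // [J 2%N _]J_ge2 // J2 !addr0.
(* For n >= 3 one of i and n - i exceeds 1. *)
rewrite big1 // => i _; apply: J_ge2.
case: (ltnP 1 i) => //= le_i1.
by rewrite ltn_subRL (leq_ltn_trans (leq_add le_i1 (leqnn 1))).
Qed.

Lemma hbar_deformation :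
  (forall t : K, t != 0 -> jacobi (hbar_bracket K m t)) ->
  lie_deformation (po_bracket K m) (hbar_bracket K m).
Proof.
move=> jac; exists po_coefficient, 1%N; split=> //; first exact: hbar_formal.
  by case=> [|[|k]].
move=> t f g; rewrite hbar_bracketE big_ord_recl big_ord1 /=.
by rewrite expr0 scale1r expr1.
Qed.

End Deformation.

Theorem proposition5p1 (K : closedFieldType) (charK : 2%N \in [pchar K])
    (m : nat) (m_ge3 : (3 <= m)%N)
    (V : vectType 'F_2) (dimV : \dim {: V} = (2 * m)%N)
    (B : {skew_symmetric V})
    (Balt : forall v : V, B v v = 0) (Bnondeg : nondegenerate B) :
  lie_isomorphic (kap4 K B) (log_bracket K m)
  /\
  [/\ lie_deformation (po_bracket K m) (hbar_bracket K m),
      forall hbar : K, hbar != 0 ->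
        lie_isomorphic (kap4 K B) (hbar_bracket K m hbar) &
      exists c : {vspace kap_space K [set: finvect_type V]},
        [/\ is_center (kap4 K B) c,
            lie_isomorphic (kap4 K B)
              (sum_bracket (kap2 K B) (@sub_bracket _ _ (kap4 K B) c)),
            c = <[kap_basis K [set: finvect_type V] 0%R]>%VS,
            is_center (log_bracket K m) <[1%R : Oalg K m]>%VS &
            forall hbar : K, hbar != 0 ->
              is_center (hbar_bracket K m hbar) <[1%R : Oalg K m]>%VS]].
Proof.
have kap4_Lie := kap4_lie charK Balt.
have kap4_ctr : is_center (kap4 K B) _ := kap4_center Balt Bnondeg.
have [b b_symp] : exists b : 'I_m + 'I_m -> V, symplectic B b.
  by apply: symplectic_family; rewrite ?dimV.
have realize (w : 'I_m -> Oalg K m) kappa z : kappa != 0 ->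
    (forall j, z j * z j = 1) -> log_canonical (weighted_bracket w) kappa z ->
    generates z ->
    lie_isomorphic (kap4 K B) (weighted_bracket w)
    /\ is_center (weighted_bracket w) <[1 : Oalg K m]>%VS.
  move=> kappa_neq0 z_sqr z_log z_gen.
  have phi_bij := scaled_exponential_bij dimV kappa_neq0 z_sqr z_gen b_symp.
  have phiM := scaled_exponential_morph charK Balt dimV kappa_neq0 z_sqr z_log b_symp.
  split; first exact: lie_isomorphic_domain kap4_Lie phi_bij phiM.
  have := is_center_line_image phi_bij phiM kap4_ctr.
  rewrite /= kap_extend_basis ?in_setT // /scaled_exponential exponential0.
  by rewrite line_scale ?invr_eq0.
have real_log : lie_isomorphic (kap4 K B) (log_bracket K m)
    /\ is_center (log_bracket K m) <[1 : Oalg K m]>%VS.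
  apply: (realize _ 1 (@log_coord K m)); first exact: oner_neq0.
  - exact: log_coord_sqr.
  - exact: log_coord_canonical.
  - exact: log_coord_generates.
have real_hbar hbar : hbar != 0 ->
    lie_isomorphic (kap4 K B) (hbar_bracket K m hbar)
    /\ is_center (hbar_bracket K m hbar) <[1 : Oalg K m]>%VS.
  move=> hbar_neq0; apply: (realize _ hbar (@hbar_coord K m hbar)) => //.
  - exact: hbar_coord_sqr.
  - exact: hbar_coord_canonical.
  - exact: hbar_coord_generates.
split; first by case: real_log.
split.
- by apply: hbar_deformation => // t /real_hbar[[_ []]].
- by move=> hbar /real_hbar[].
- exists <[kap_basis K [set: finvect_type V] 0%R]>%VS; split=> //.
  + exact: kap4_split.
  + by case: real_log.
  + by move=> hbar /real_hbar[].
Qed.
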